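(* Let $G=(V,\mathcal D,\mathcal B)$ be an acyclic directed mixed graph with linear structural equation model covariance matrix $\Sigma$, let $a^*\to b\in\mathcal D$, and let $G^*$, with covariance matrix $\Sigma^*$, be obtained from $G$ by removing the directed edge $a^*\to b$. Let $C=\operatorname{de}(b)\setminus\{b\}$. Then $\Sigma^*$ is identifiable given $\Sigma$ if and only if both $\lambda_{a^*b}$ is identifiable and $\sigma(\mathcal D_{bc})$ is identifiable for all $c\in C$.
   Context: An acyclic directed mixed graph (ADMG) $G=(V,\mathcal D,\mathcal B)$ has a finite vertex set $V$, a set $\mathcal D$ of directed edges and a set $\mathcal B$ of bidirected edges, with no loops and no directed cycles; a pair of vertices may be joined by both a directed and a bidirected edge. The parameter space $\Theta$ consists of pairs $(\Lambda,\Omega)$ where $\Lambda=(\lambda_{ij})\in\mathbb R^{V\times V}$ has $\lambda_{ij}=0$ unless $i\to j\in\mathcal D$, and $\Omega=(\omega_{ij})$ is symmetric positive definite with $\omega_{ij}=0$ unless $i=j$ or $i\leftrightarrow j\in\mathcal B$. The model covariance matrix is $\Sigma=\phi(\Lambda,\Omega)=(I-\Lambda)^{-T}\Omega(I-\Lambda)^{-1}$. $\operatorname{de}(v)$ is the set of descendants of $v$ (vertices reachable from $v$ by a directed path, including $v$ itself). Removing the edge $a^*\to b$: $\Sigma^*=(I-\Lambda^* )^{-T}\Omega(I-\Lambda^* )^{-1}$, where $\Lambda^*$ is $\Lambda$ with the entry $\lambda_{a^*b}$ replaced by $0$. $\mathcal D_{uv}$ is the set of directed paths from $u$ to $v$ in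 $G$, and $\sigma(\mathcal D_{uv})=\sum_{\tau\in\mathcal D_{uv}}\prod_{x\to y\in\tau}\lambda_{xy}$. Identifiability: a (vector- or matrix-valued) function $f$ on $\Theta$ is identifiable (given $\Sigma$) if for Lebesgue-almost all $\theta\in\Theta$ the function $f$ is constant on the fibre $\phi^{-1}(\phi(\theta))$. ''$\Sigma^*$ is identifiable given $\Sigma$'' means this for $f=\Sigma^*$ as a function of $(\Lambda,\Omega)$. *)

(* Defs.v *)
From HB Require Import structures.
From mathcomp Require Import all_boot all_order all_algebra.
From mathcomp Require Import all_classical all_reals all_analysis.

Set Implicit Arguments.
Unset Strict Implicit.
Unset Printing Implicit Defensive.

Import Order.TTheory GRing.Theory Num.Theory.

Local Open Scope classical_set_scope.
Local Open Scope ring_scope.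

Section cons_measure.
Context d (T : measurableType d) (R : realType) (n : nat).
Variable mu : {sigma_finite_measure set T -> \bar R}.
Variable nu : {sigma_finite_measure set (n.-tuple T) -> \bar R}.

Definition cons_pair (p : T * n.-tuple T) : n.+1.-tuple T :=
  [tuple of p.1 :: p.2].

Lemma measurable_cons_pair : measurable_fun setT cons_pair.
Proof. exact: measurable_cons. Qed.

Definition cons_measure : set (n.+1.-tuple T) -> \bar R :=
  pushforward (mu \x nu)%E cons_pair.

HB.instance Definition _ := Measure.copy cons_measure
  (measure_function_pushforward__canonical__measure_function_Measure
    (mu \x nu)%E measurable_cons_pair).

Lemma cons_measure_sigma_finite : sigma_finite setT cons_measure.
Proof.
have /sigma_finiteP[F [FT ndF mF]] := sigma_finiteT mu.
have /sigma_finiteP[H [HT ndH mH]] := sigma_finiteT nu.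
pose uncons (t : n.+1.-tuple T) : T * n.-tuple T :=
  (tnth t ord0, [tuple of behead t]).
have unconsK : cancel cons_pair uncons.
  by move=> [x t]; congr pair; apply/val_inj.
have muncons : measurable_fun setT uncons.
  apply: measurable_fun_pair; first exact: measurable_tnth.
  exact: measurable_behead.
exists (fun k => uncons @^-1` (F k `*` H k)).
  apply/esym; rewrite -subTset => t _.
  have [k _ Fkt] : (\bigcup_k F k) (uncons t).1 by rewrite -FT.
  have [l _ Hlt] : (\bigcup_k H k) (uncons t).2 by rewrite -HT.
  exists (maxn k l) => //; split.
  - by move: Fkt; exact/subsetPset/ndF/leq_maxl.
  - by move: Hlt; exact/subsetPset/ndH/leq_maxr.
move=> k; have [mFk Fk] := mF k; have [mHk Hk] := mH k; split.
  by rewrite -[X in measurable X]setTI; apply: muncons => //; exact: measurableX.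
rewrite /cons_measure /pushforward -comp_preimage.
rewrite (_ : uncons \o cons_pair = id); last exact/funext/unconsK.
by rewrite preimage_id product_measure1E// lte_mul_pinfty// ge0_fin_numE.
Qed.

HB.instance Definition _ :=
  Measure_isSigmaFinite.Build _ _ _ cons_measure cons_measure_sigma_finite.

End cons_measure.

(* Lebesgue measure on R^n, as the n-fold product of Lebesgue measure on R;
   on the one-point space R^0 it has total mass 1. *)
Fixpoint lebesgue_tuple (R : realType) (n : nat) :
    {sigma_finite_measure set (n.-tuple (measurableTypeR R)) -> \bar R} :=
  if n is m.+1 then cons_measure (@lebesgue_measure R) (lebesgue_tuple R m)
  else dirac (nil_tuple _).

Record admg (n : nat) := ADMG {
  directed : rel 'I_n;
  bidirected : rel 'I_n;
  bidirected_sym : symmetric bidirected;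
  bidirected_irrefl : irreflexive bidirected;
  (* [cycle directed [:: v]] is a loop at v, so loops are excluded as well. *)
  directed_acyclic : forall p : seq 'I_n, cycle directed p -> p = [::]
}.

Definition descendants (n : nat) (G : admg n) (v : 'I_n) : {set 'I_n} :=
  [set w | connect (directed G) v w].

(* A path from u to v is encoded by its vertices after u. In an acyclic graph
   a path has at most n - 1 edges, so the bound on the length loses nothing. *)
Definition directed_paths (n : nat) (G : admg n) (u v : 'I_n) :
    {set n.-bseq 'I_n} :=
  [set p : n.-bseq 'I_n | path (directed G) u p && (last u p == v)].

Section model.
Context {R : realType} {n : nat}.

Definition path_weight (L : 'M[R]_n) (u : 'I_n) (p : seq 'I_n) : R :=
  \prod_(e <- zip (u :: p) p) L e.1 e.2.

Definition path_sum (G : admg n) (u v : 'I_n) (L : 'M[R]_n) : R :=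
  \sum_(p in directed_paths G u v) path_weight L u p.

Definition positive_definite (W : 'M[R]_n) : Prop :=
  W^T = W /\ forall v : 'cV[R]_n, v != 0 -> 0 < (v^T *m W *m v) 0 0.

Definition Theta (G : admg n) : set ('M[R]_n * 'M[R]_n) :=
  [set t : 'M[R]_n * 'M[R]_n |
    [/\ forall i j, ~~ directed G i j -> t.1 i j = 0,
        positive_definite t.2 &
        forall i j, i != j -> ~~ bidirected G i j -> t.2 i j = 0]].

Definition phi (t : 'M[R]_n * 'M[R]_n) : 'M[R]_n :=
  (invmx (1%:M - t.1))^T *m t.2 *m invmx (1%:M - t.1).

Definition remove_edge (a b : 'I_n) (L : 'M[R]_n) : 'M[R]_n :=
  \matrix_(i, j) if (i == a) && (j == b) then 0 else L i j.

Definition phi_star (a b : 'I_n) (t : 'M[R]_n * 'M[R]_n) : 'M[R]_n :=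
  phi (remove_edge a b t.1, t.2).

(* The free parameters of Theta G: one entry of Lambda per directed edge, and,
   Omega being symmetric, one entry of Omega per vertex and bidirected edge. *)
Definition param_index (G : admg n) : finType :=
  ({e : 'I_n * 'I_n | directed G e.1 e.2} +
   {e : 'I_n * 'I_n |
     (e.1 == e.2) || (e.1 < e.2)%N && bidirected G e.1 e.2})%type.

Definition coordinates (G : admg n) (t : 'M[R]_n * 'M[R]_n) :
    #|param_index G|.-tuple (measurableTypeR R) :=
  [tuple match enum_val k with
         | inl e => t.1 (val e).1 (val e).2
         | inr e => t.2 (val e).1 (val e).2
         end | k < #|param_index G|].

(* [coordinates G] is injective on Theta G, with image an open subset of
   Euclidean space; Lebesgue measure on Theta G is the one of that space. *)
Definition almost_all (G : admg n) (P : 'M[R]_n * 'M[R]_n -> Prop) : Prop :=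
  (lebesgue_tuple R #|param_index G|).-negligible
    (coordinates G @` (Theta G `&` [set t | ~ P t])).

Definition fibre (G : admg n) (t : 'M[R]_n * 'M[R]_n) :
    set ('M[R]_n * 'M[R]_n) :=
  Theta G `&` [set t' | phi t' = phi t].

Definition identifiable (G : admg n) (T : Type)
    (f : 'M[R]_n * 'M[R]_n -> T) : Prop :=
  almost_all G
    (fun t => forall t1 t2, fibre G t t1 -> fibre G t t2 -> f t1 = f t2).

End model.

(* Main.v *)
(* With [w] the row vector of entries lambda_ab * sigma(D_bc) and [e_a] the
   basis column vector, acyclicity gives
     (I - Lambda^* )^-1 = (I - Lambda)^-1 (I - e_a w),
   hence Sigma^* = (I - e_a w)^T Sigma (I - e_a w), so that Sigma^* is a
   function of Sigma and w. Conversely w_a = 0, so the row [a] of Sigma^* is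
   that of Sigma minus Sigma_aa w, and Sigma_aa > 0: [w] is a function of Sigma
   and Sigma^*. Finally lambda_ab = w_b, and sigma(D_bc) = w_c / w_b outside of
   the null set lambda_ab = 0. *)
Require Import Defs.
From mathcomp Require Import all_boot all_order all_algebra.
From mathcomp Require Import all_classical all_reals all_analysis.

Set Implicit Arguments.
Unset Strict Implicit.
Unset Printing Implicit Defensive.

Import Order.TTheory GRing.Theory Num.Theory.

Local Open Scope classical_set_scope.
Local Open Scope ring_scope.

(** * Coordinate hyperplanes are null *)

Section lebesgue_tuple.
Variable R : realType.

Lemma measurable_tnth_eq m (k : 'I_m) (x : measurableTypeR R) :
  measurable [set t : m.-tuple (measurableTypeR R) | tnth t k = x].
Proof.
have := @measurable_tnth _ (measurableTypeR R) m k measurableT [set x].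
rewrite setTI; apply; exact: (measurable_set1 x).
Qed.

(** By induction on [m]: pulled back along [cons_pair], the hyperplane is a rectangle with one null
    side, so its measure is 0 even if the other side has infinite measure. *)
Lemma lebesgue_tuple_hyperplane m (k : 'I_m) (x : measurableTypeR R) :
  lebesgue_tuple R m [set t | tnth t k = x] = 0%E.
Proof.
elim: m k => [[]//|m IH] k /=; rewrite /cons_measure /pushforward.
case: (unliftP ord0 k) => [j|] ->.
  rewrite (_ : _ @^-1` _ = setT `*` [set t | tnth t j = x]).
    rewrite product_measure1E//; first by rewrite IH mule0.
    exact: measurable_tnth_eq.
  by apply/seteqP; split=> -[y t] /=; rewrite !(tnth_nth x)//= => -[].
rewrite (_ : _ @^-1` _ = [set x] `*` setT).
  by rewrite product_measure1E// [X in (X * _)%E](lebesgue_measure_set1 x) mul0e.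
by apply/seteqP; split=> -[y t] /=; rewrite (tnth_nth x)//= => -[].
Qed.

End lebesgue_tuple.

(** * Almost all parameters *)

Section almost_all.
Context {R : realType} {n : nat} (G : admg n).
Implicit Type P Q : 'M[R]_n * 'M[R]_n -> Prop.

Lemma almost_all_Theta P : (forall t, Theta G t -> P t) -> almost_all G P.
Proof.
move=> PT; rewrite /almost_all (_ : _ `&` _ = set0).
  by rewrite image_set0; exact: negligible_set0.
by apply/seteqP; split=> // t [/PT].
Qed.

Lemma almost_all_filter : Filter (@almost_all R n G).
Proof.
split; first exact: almost_all_Theta.
- move=> P Q aP aQ; apply: negligibleS (negligibleU aP aQ).
  move=> _ [t [Tt /not_andP[nP|nQ]] <-]; [left|right]; by exists t.
- move=> P Q PQ; apply: negligibleS; apply: image_subset => t [Tt nQ].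
  by split=> // /PQ.
Qed.

(** The entry at an edge is a free coordinate, with rank [k], so the exceptional parameters lie in a
    coordinate hyperplane. *)
Lemma almost_all_edge_neq0 (a b : 'I_n) :
  directed G a b -> almost_all G (fun t : 'M[R]_n * 'M[R]_n => t.1 a b <> 0).
Proof.
move=> hab; pose k := enum_rank (inl (exist _ (a, b) hab) : param_index G).
pose H := [set u : #|param_index G|.-tuple (measurableTypeR R) |
  tnth u k = (0 : R)].
apply: (@negligibleS _ _ _ _ H); last first.
  apply/negligibleP; first exact: measurable_tnth_eq.
  exact: lebesgue_tuple_hyperplane.
move=> _ [t [_ /contrapT t0] <-] /=.
by rewrite /H/= /coordinates tnth_mktuple enum_rankK.
Qed.

End almost_all.

(** * Directed paths in an acyclic graph *)

Section acyclic.
Context {n : nat} (G : admg n).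

Lemma no_cycle u p :
  path (directed G) u p -> last u p = u -> p = [::].
Proof.
case/lastP: p => // p v; rewrite last_rcons => /[swap] -> up.
by have /directed_acyclic : cycle (directed G) (u :: p) by [].
Qed.

Lemma directed_path_uniq u p : path (directed G) u p -> uniq (u :: p).
Proof.
elim: p u => // v p IH u uvp; have /= /andP[_ vp] := uvp.
rewrite [uniq _]/= -/(uniq (v :: p)) IH// andbT; apply/negP => upn.
(* A second visit to [u] would cut off the nonempty closed path [rcons p1 u]. *)
case/splitPr: upn uvp => p1 p2; rewrite -cat_rcons cat_path => /andP[c _].
by have := no_cycle c (last_rcons _ _ _) => /(congr1 size); rewrite size_rcons.
Qed.

(** The strict bound leaves room to prepend one vertex within [n.-bseq]. *)
Lemma size_directed_path u p : path (directed G) u p -> (size p < n)%N.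
Proof.
move=> /directed_path_uniq/card_uniqP/= <-.
by rewrite -[X in (_ <= X)%N]card_ord max_card.
Qed.

End acyclic.

(** * Path sums as the entries of the inverse of I - Lambda *)

Section path_sum.
Context {R : realType} {n : nat} (G : admg n) (L : 'M[R]_n).

Lemma path_sum_notin_descendants u v :
  v \notin descendants G u -> path_sum G u v L = 0.
Proof.
rewrite inE => nuv; rewrite /path_sum big1// => p; rewrite inE => /andP[up /eqP].
by move=> lp; case/negP: nuv; apply/connectP; exists p.
Qed.

Lemma path_sum_edge_rev a b : directed G a b -> path_sum G b a L = 0.
Proof.
move=> hab; apply: path_sum_notin_descendants; rewrite inE.
apply/negP => /connectP[p bp ap].
suff : b :: p = [::] by [].
by apply: (@no_cycle _ G a); rewrite /= -?ap// hab.
Qed.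

Lemma path_sum_refl u : path_sum G u u L = 1.
Proof.
rewrite /path_sum (big_pred1 [bseq]); first by rewrite /path_weight big_nil.
move=> p; rewrite inE; apply/idP/eqP => [/andP[up /eqP lp]|->/=].
  exact/val_inj/(no_cycle up lp).
exact/eqxx.
Qed.

Lemma path_weight_cons u v p :
  path_weight L u (v :: p) = L u v * path_weight L v p.
Proof. by rewrite /path_weight big_cons. Qed.

Hypothesis L0 : forall i j, ~~ directed G i j -> L i j = 0.

(** Split by the first edge: the empty path gives the Kronecker delta, any other path is an edge
    from [u] to some [x] followed by a path from [x]. *)
Lemma path_sum_step u v :
  path_sum G u v L = (u == v)%:R + \sum_x L u x * path_sum G x v L.
Proof.
rewrite {1}/path_sum (bigID (fun p : n.-bseq 'I_n => nilp p))/=; congr (_ + _).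
  have [<-|uv] := eqVneq.
    rewrite (big_pred1 [bseq]); first by rewrite /path_weight big_nil.
    move=> p; rewrite inE /=; case: p => -[|x p] sp /=.
      by rewrite eqxx; apply/esym/eqP/val_inj.
    by rewrite andbF; apply/esym/eqP => /(congr1 val).
  rewrite big1// => p; rewrite inE => /andP[/andP[_ +] /nilP p0].
  by rewrite p0 /= (negbTE uv).
(* [h] prepends a vertex and [h'] removes it. [insub_bseq] falls back to the empty sequence when
   [x :: q] is too long; [hE] and the condition that the path is not [nilp] rule this out. *)
pose h (xq : 'I_n * n.-bseq 'I_n) := insub_bseq n (xq.1 :: xq.2).
pose h' (p : n.-bseq 'I_n) :=
  (head u p, Bseq (leq_trans (size_bseq [bseq of behead p]) (leq_pred n))).
have hE x (q : n.-bseq 'I_n) : path (directed G) x q ->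
    h (x, q) = x :: q :> seq 'I_n.
  move=> /size_directed_path sq.
  by rewrite /h /insub_bseq val_insubd /= sq.
rewrite (reindex_onto h h')/=; last first.
  move=> [[|x q] sp] /andP[_ //] _; apply/val_inj.
  by rewrite /h /insub_bseq val_insubd /= ifT.
rewrite (eq_bigr _ (fun x _ => big_distrr _ _ _))/=.
(* Terms with no edge from [u] to [x] vanish by [L0]. *)
rewrite pair_big_dep/= [RHS](bigID (fun xq => directed G u xq.1))/=.
rewrite [X in _ = _ + X]big1 ?addr0; last first.
  by move=> [x q] /andP[_ /L0/= ->]; rewrite mul0r.
apply: eq_big => [[x q]|[x q]] /=.
  rewrite !inE.
  apply/idP/idP => [/andP[/andP[/andP[up /eqP lp] np] /eqP hp]|].
    have e : h (x, q) = x :: q :> seq 'I_n.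
      move: hp np; case: (h (x, q)) => -[//|y s] sp /= [-> <-] _ //.
    by move: up lp; rewrite e /= => /andP[-> ->] ->; rewrite eqxx.
  move=> /andP[/andP[xq /eqP lq] ux].
  rewrite hE//= ux xq lq eqxx /=; apply/eqP; congr pair; first by rewrite hE.
  by apply: val_inj; rewrite /= hE.
move=> /andP[/andP[+ np] /eqP hp]; rewrite inE => /andP[up _].
have -> : val (h (x, q)) = x :: q.
  move: hp np; case: (h (x, q)) => -[//|y s] sp /= [-> <-] _ //.
exact: path_weight_cons.
Qed.

(** This is [path_sum_step] in matrix form, P = I + L P. *)
Lemma path_sum_mx_inv :
  (1%:M - L) *m (\matrix_(i, j) path_sum G i j L) = 1%:M.
Proof.
apply/matrixP => i j; rewrite mulmxBl mul1mx !mxE path_sum_step.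
by under [X in _ - X]eq_bigr do rewrite mxE; rewrite addrK.
Qed.

Lemma one_sub_unitmx : 1%:M - L \in unitmx.
Proof. by have [] := mulmx1_unit path_sum_mx_inv. Qed.

Lemma invmx_one_sub : invmx (1%:M - L) = \matrix_(i, j) path_sum G i j L.
Proof.
by rewrite -[RHS](mulKmx one_sub_unitmx) path_sum_mx_inv mulmx1.
Qed.

End path_sum.

(** * The covariance matrix after removing an edge *)

Section remove_edge.
Context {R : realType} {n : nat} (G : admg n) (a b : 'I_n).
Hypothesis hab : directed G a b.

(** Entry [c] collects the directed paths from [a] to [c] that start with the edge from [a] to
    [b]. *)
Definition edge_effects (L : 'M[R]_n) : 'rV[R]_n :=
  \row_c (L a b * path_sum G b c L).

Lemma edge_effects_tail L : edge_effects L 0 a = 0.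
Proof. by rewrite mxE (path_sum_edge_rev _ hab) mulr0. Qed.

Lemma edge_effects_head L : edge_effects L 0 b = L a b.
Proof. by rewrite mxE path_sum_refl mulr1. Qed.

(** Removing the edge changes I - Lambda by a rank-one matrix, as in the Sherman-Morrison formula;
    its denominator is 1 because no path leads from [b] back to [a]. *)
Lemma phi_starE (t : 'M[R]_n * 'M[R]_n) : Theta G t ->
  let K := 1%:M - delta_mx a 0 *m edge_effects t.1 in
  phi_star a b t = K^T *m phi t *m K.
Proof.
case: t => L W [/= L0 _ _]; set w := edge_effects L.
have wE : w = L a b *: row b (invmx (1%:M - L)).
  by apply/rowP => c; rewrite (invmx_one_sub L0) !mxE.
have LE : 1%:M - remove_edge a b L = 1%:M - L + L a b *: delta_mx a b.
  apply/matrixP => i j; rewrite !mxE; case: ifPn => [/andP[/eqP-> /eqP->]|_].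
    by rewrite mulr1 subr0 subrK.
  by rewrite mulr0 addr0.
have inv1 : (1%:M - remove_edge a b L) *m
    (invmx (1%:M - L) *m (1%:M - delta_mx a 0 *m w)) = 1%:M.
  have rowM : delta_mx a b *m invmx (1%:M - L) =
      delta_mx a (0 : 'I_1) *m row b (invmx (1%:M - L)).
    by rewrite rowE mulmxA mul_delta_mx.
  rewrite LE mulmxDl mulKVmx ?(one_sub_unitmx L0)// -scalemxAl mulmxA rowM.
  (* The quadratic term in [w] contains entry (b, a) of the inverse, which is 0 by acyclicity. *)
  rewrite -mulmxA mulmxBr mulmx1 mulmxA [row b _ *m _](_ : _ = 0).
    by rewrite mul0mx subr0 scalemxAr -wE subrK.
  apply/matrixP => i j; rewrite -colE (invmx_one_sub L0) !mxE.
  exact: path_sum_edge_rev.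
have -> : phi_star a b (L, W) =
  (invmx (1%:M - remove_edge a b L))^T *m W *m invmx (1%:M - remove_edge a b L).
  by [].
have -> : invmx (1%:M - remove_edge a b L) =
    invmx (1%:M - L) *m (1%:M - delta_mx a 0 *m w).
  have [U _] := mulmx1_unit inv1.
  by rewrite -[RHS](mulKmx U) inv1 mulmx1.
by rewrite /phi /= trmx_mul !mulmxA.
Qed.

Lemma row_phi_star (t : 'M[R]_n * 'M[R]_n) : Theta G t ->
  row a (phi_star a b t) = row a (phi t) - phi t a a *: edge_effects t.1.
Proof.
move=> Tt; rewrite (phi_starE Tt); move: (phi t) => S; rewrite !row_mul.
rewrite [row a _^T](_ : _ = delta_mx 0 a); last first.
  apply/rowP => j; rewrite !mxE big_ord1 edge_effects_tail mulr0 subr0 eqxx /=.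
  by rewrite eq_sym.
rewrite -rowE mulmxBr mulmx1 mulmxA -colE; congr (_ - _).
by apply/rowP => j; rewrite !mxE big_ord1 !mxE.
Qed.

(** The entry is the quadratic form of Omega at column [i] of an invertible matrix. *)
Lemma phi_diag_gt0 (t : 'M[R]_n * 'M[R]_n) (i : 'I_n) :
  Theta G t -> 0 < phi t i i.
Proof.
case: t => L W [/= L0 [_ Wpos] _].
have U := one_sub_unitmx L0.
have vn0 : col i (invmx (1%:M - L)) != 0.
  apply/eqP => /(congr1 (mulmx (1%:M - L))); rewrite colE mulKVmx// mulmx0.
  by move=> /matrixP/(_ i 0)/eqP; rewrite !mxE !eqxx oner_eq0.
have := Wpos _ vn0; rewrite tr_col rowE colE !mulmxA -colE -!mulmxA -rowE mxE mxE.
by rewrite /phi/= !mulmxA.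
Qed.

Lemma eq_phi_star (t1 t2 : 'M[R]_n * 'M[R]_n) : Theta G t1 -> Theta G t2 ->
  phi t1 = phi t2 ->
  phi_star a b t1 = phi_star a b t2 <-> edge_effects t1.1 = edge_effects t2.1.
Proof.
move=> T1 T2 e; split => [es|ew]; last by rewrite !phi_starE// e ew.
have := row_phi_star T1; rewrite es row_phi_star// e => /addrI/oppr_inj/esym.
by apply: scalerI; rewrite gt_eqF// phi_diag_gt0.
Qed.

End remove_edge.

Theorem proposition3p6 (R : realType) (n : nat) (G : admg n) (a b : 'I_n)
    (hab : directed G a b) :
  identifiable G (fun t : 'M[R]_n * 'M[R]_n => phi_star a b t) <->
  identifiable G (fun t : 'M[R]_n * 'M[R]_n => t.1 a b) /\
  (forall c : 'I_n, c \in descendants G b :\ b ->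
     identifiable G (fun t : 'M[R]_n * 'M[R]_n => path_sum G b c t.1)).
Proof.
have F := @almost_all_filter R n G.
rewrite /identifiable; split => [idS|[idl idp]].
  split=> [|c _].
    apply: filterS idS => t idS t1 t2 f1 f2.
    have [[T1 e1] [T2 e2]] := (f1, f2).
    have /(eq_phi_star hab T1 T2 (etrans e1 (esym e2))) := idS _ _ f1 f2.
    by move=> /rowP/(_ b); rewrite !edge_effects_head.
  (* Keeping [t] in [Theta G] puts it in its own fibre. Every fibre point is compared with [t], so
     division by the edge coefficient needs it to be nonzero at [t] only. *)
  apply: filterS (filterI (almost_all_edge_neq0 hab)
    (filterI idS (almost_all_Theta (fun t (Tt : Theta G t) => Tt)))).
  move=> t [/eqP l0 [idS' Tt]].
  suff fp t' : fibre G t t' -> path_sum G b c t'.1 = path_sum G b c t.1.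
    by move=> t1 t2 /fp -> /fp ->.
  move=> f'; have [T' e'] := f'.
  have /(eq_phi_star hab T' Tt e') ew : phi_star a b t' = phi_star a b t.
    exact: idS'.
  have := congr1 (fun w : 'rV_n => w 0 b) ew.
  rewrite /= !edge_effects_head => el.
  by have := congr1 (fun w : 'rV_n => w 0 c) ew; rewrite /= !mxE el; exact: mulfI.
(* With membership as a premise, [c] ranges over the finite type ['I_n], and finitely many null sets
   are united. *)
pose P c (t : 'M[R]_n * 'M[R]_n) := c \in descendants G b :\ b ->
  forall t1 t2, fibre G t t1 -> fibre G t t2 ->
  path_sum G b c t1.1 = path_sum G b c t2.1.
have {}idp : almost_all G (fun t => forall c, P c t).
  apply: (@filter_forall _ _ P _ F) => c.
  have [cb|/negP ncb] := boolP (c \in descendants G b :\ b).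
    by apply: filterS (idp c cb) => t h _; exact: h.
  by apply: almost_all_Theta => t _ /ncb.
apply: filterS (filterI idl idp) => t [idl' idp'] t1 t2 f1 f2.
have [[T1 e1] [T2 e2]] := (f1, f2).
apply/(eq_phi_star hab T1 T2 (etrans e1 (esym e2)))/rowP => c.
rewrite !mxE (idl' _ _ f1 f2); congr (_ * _).
(* Outside C the path sum is constant: 1 at [b], 0 at non-descendants. *)
have [cb|] := boolP (c \in descendants G b :\ b); first exact: idp'.
rewrite in_setD1 negb_and negbK => /orP[/eqP->|nc].
  by rewrite !path_sum_refl.
by rewrite !path_sum_notin_descendants.
Qed.
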